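(* Let $F(A,b,\ell,u,c)$ be a linear program with $A\in\mathbb{R}^{V\times W}$, $b\in\mathbb{R}^V$, $c\in\mathbb{R}^W$, $\ell_w\in\mathbb{R}_{\le 0}\cup\{-\infty\}$ and $u_w\in\mathbb{R}_{\ge 0}\cup\{\infty\}$ for all $w\in W$. The coarsest bound-respecting and equitable partition $(\widehat{\mathcal P},\widehat{\mathcal Q})$ of the split reformulation $F_S(A,b,\ell,u,c)$ is symmetric.
   Context: $V$ and $W$ are disjoint finite sets. $F(A,b,\ell,u,c)$ denotes the linear program $\min\{c^{\top}x : Ax=b,\ \ell\le x\le u\}$. Equitable partitions. For a matrix $M\in\mathbb{R}^{V\times W}$, a partition $\mathcal P$ of $V$ and a partition $\mathcal Q$ of $W$, $(\mathcal P,\mathcal Q)$ is equitable for $M$ if for all $P\in\mathcal P$, $Q\in\mathcal Q$: $\sum_{w\in Q}M_{v,w}=\sum_{w\in Q}M_{v',w}$ for all $v,v'\in P$, and $\sum_{v\in P}M_{v,w}=\sum_{v\in P}M_{v,w'}$ for all $w,w'\in Q$. A partition is an equitable partition of a vector if the vector is constant on each part. $(\mathcal P,\mathcal Q)$ is an equitable partition of $F(A,b,\ell,u,c)$ if it is equitable for $A$, $\mathcal P$ is an equitable partition of $b$, and $\mathcal Q$ is an equitable partition of $\ell$, $u$ and $c$. Split reformulation. For $\ell\le 0\le u$, $F_S(A,b,\ell,u,c)$ is the linear program in variables $x^+,x^-\in\mathbb{R}^W$: $\min c^{\top}x^+-c^{\top}x^-$ s.t. $Ax^+-Ax^-=b$,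 $-Ax^++Ax^-=-b$, $0\le x^+\le u$, $0\le x^-\le-\ell$. Its constraint matrix is $\widehat M=\begin{bmatrix}A&-A\\-A&A\end{bmatrix}$ with row index set $\widehat V=\widehat V^+\cup\widehat V^-$ and column index set $\widehat W=\widehat W^+\cup\widehat W^-$ (two copies $v^+,v^-$ of each $v\in V$ and $w^+,w^-$ of each $w\in W$). A partition $(\widehat{\mathcal P},\widehat{\mathcal Q})$ (of $\widehat V$ and $\widehat W$ respectively) is bound-respecting if for all $Q\in\widehat{\mathcal Q}$ and any $w_1^{s_1},w_2^{s_2}\in Q$ (with signs $s_1,s_2$): $\ell_{w_1}=\ell_{w_2}$ and $u_{w_1}=u_{w_2}$ if $s_1=s_2$; and $\ell_{w_1}=-u_{w_2}$ and $u_{w_1}=-\ell_{w_2}$ if $s_1\ne s_2$. For $P\subseteq V$ and $\gamma\in\{-1,1\}^P$, $P^{\gamma}=\{v^{+}:v\in P,\gamma_v=1\}\cup\{v^-:v\in P,\gamma_v=-1\}$; similarly $Q^\lambda$ for $Q\subseteq W$, $\lambda\in\{-1,1\}^Q$. A part $\widehat P\subseteq\widehat V$ is bipolar if $\{v^+,v^-\}\subseteq\widehat P$ for some $v\in V$, and unipolar otherwise (then $\widehat P=P^\gamma$ for suitable $P,\gamma$); likewise for parts of $\widehat W$. $(\widehat{\mathcal P},\widehat{\mathcal Q})$ is symmetric if (i) for every unipolar $P^{\gamma}\in\widehat{\mathcal P}$ also $P^{-\gamma}\in\widehat{\mathcal P}$; (ii) every bipolar part of $\widehat{\mathcal P}$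 contains, for each $v\in V$, both or none of $v^+,v^-$; (iii) for every unipolar $Q^\lambda\in\widehat{\mathcal Q}$ also $Q^{-\lambda}\in\widehat{\mathcal Q}$; (iv) every bipolar part of $\widehat{\mathcal Q}$ contains, for each $w\in W$, both or none of $w^+,w^-$. A partition $\mathcal P_1$ refines $\mathcal P_2$ if each part of $\mathcal P_1$ is contained in a part of $\mathcal P_2$; the coarsest partition with a property is the one that every partition with that property refines. *)

(* Defs.v *)
From HB Require Import structures.
From mathcomp Require Import all_boot all_order all_algebra.
From mathcomp Require Import constructive_ereal reals.

Set Implicit Arguments.
Unset Strict Implicit.
Unset Printing Implicit Defensive.

Import Order.TTheory GRing.Theory Num.Theory.
Local Open Scope ring_scope.

(* LP A b l u c is the data of the program
     min { c^T x : A x = b, l <= x <= u };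
   the bounds are extended reals. *)
Record lp (R : realType) (V W : finType) := LP {
  lp_mx : V -> W -> R;
  lp_rhs : V -> R;
  lp_lower : W -> \bar R;
  lp_upper : W -> \bar R;
  lp_cost : W -> R
}.

Definition refines (T : finType) (P1 P2 : {set {set T}}) : Prop :=
  forall B, B \in P1 -> exists2 C, C \in P2 & B \subset C.

(* Refinement of pairs of partitions is componentwise. *)
Definition coarsest (V W : finType)
    (Phi : {set {set V}} -> {set {set W}} -> Prop)
    (P : {set {set V}}) (Q : {set {set W}}) : Prop :=
  Phi P Q /\ forall P' Q', Phi P' Q' -> refines P' P /\ refines Q' Q.

Definition equitable_mx (R : realType) (V W : finType) (M : V -> W -> R)
    (P : {set {set V}}) (Q : {set {set W}}) : Prop :=
  forall B C, B \in P -> C \in Q ->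
    {in B &, forall v v', \sum_(w in C) M v w = \sum_(w in C) M v' w} /\
    {in C &, forall w w', \sum_(v in B) M v w = \sum_(v in B) M v w'}.

Definition equitable_vec (T : finType) (S : Type) (f : T -> S)
    (P : {set {set T}}) : Prop :=
  forall B, B \in P -> {in B &, forall x y, f x = f y}.

Definition equitable_lp (R : realType) (V W : finType) (F : lp R V W)
    (P : {set {set V}}) (Q : {set {set W}}) : Prop :=
  [/\ partition P [set: V] /\ partition Q [set: W],
      equitable_mx (lp_mx F) P Q,
      equitable_vec (lp_rhs F) P &
      [/\ equitable_vec (lp_lower F) Q,
          equitable_vec (lp_upper F) Q &
          equitable_vec (lp_cost F) Q]].

(* Signs are booleans, true standing for + and false for -.  The two copies
   x^+ and x^- of x : T are (x, true) and (x, false) in T * bool. *)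

(* The program in x^+ and x^- obtained from x = x^+ - x^-, with constraint
   matrix [A, -A; -A, A], right-hand side (b, -b), bounds 0 <= x^+ <= u and
   0 <= x^- <= -l, and objective (c, -c). *)
Definition split_lp (R : realType) (V W : finType) (F : lp R V W) :
    lp R (V * bool)%type (W * bool)%type :=
  LP (fun v w => if v.2 == w.2 then lp_mx F v.1 w.1 else - lp_mx F v.1 w.1)
     (fun v => if v.2 then lp_rhs F v.1 else - lp_rhs F v.1)
     (fun _ => 0%E)
     (fun w => if w.2 then lp_upper F w.1 else (- lp_lower F w.1)%E)
     (fun w => if w.2 then lp_cost F w.1 else - lp_cost F w.1).

(* The bounds are those of the original program F, not of split_lp F; the
   partition of the rows plays no role. *)
Definition bound_respecting (R : realType) (V W : finType) (F : lp R V W)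
    (Q : {set {set W * bool}}) : Prop :=
  forall C, C \in Q -> forall (w1 w2 : W) (s1 s2 : bool),
    (w1, s1) \in C -> (w2, s2) \in C ->
    (s1 = s2 -> lp_lower F w1 = lp_lower F w2 /\
                lp_upper F w1 = lp_upper F w2) /\
    (s1 <> s2 -> lp_lower F w1 = (- lp_upper F w2)%E /\
                 lp_upper F w1 = (- lp_lower F w2)%E).

Definition bound_respecting_equitable (R : realType) (V W : finType)
    (F : lp R V W) (P : {set {set V * bool}}) (Q : {set {set W * bool}}) :
    Prop :=
  bound_respecting F Q /\ equitable_lp (split_lp F) P Q.

(* B^gamma; only the values of gamma on B matter. *)
Definition signed_set (T : finType) (B : {set T}) (gamma : T -> bool) :
    {set T * bool} :=
  [set x | (x.1 \in B) && (x.2 == gamma x.1)].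

Definition bipolar (T : finType) (C : {set T * bool}) : Prop :=
  exists x : T, (x, true) \in C /\ (x, false) \in C.

Definition unipolar (T : finType) (C : {set T * bool}) : Prop := ~ bipolar C.

Lemma unipolar_signed_set (T : finType) (C : {set T * bool}) :
  unipolar C <-> exists (B : {set T}) (gamma : T -> bool), C = signed_set B gamma.
Proof.
split=> [uniC | [B [gamma ->]] [x []]]; last first.
  by rewrite !inE /= => /andP[_ /eqP <-] /andP[].
exists [set x | ((x, true) \in C) || ((x, false) \in C)].
exists (fun x => (x, true) \in C).
apply/setP => -[x s]; rewrite !inE /=.
case Cp: ((x, true) \in C); case Cm: ((x, false) \in C); case: s;
  rewrite ?Cp ?Cm //.
by case: uniC; exists x.
Qed.

Definition symmetric_parts (T : finType) (P : {set {set T * bool}}) : Prop :=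
  (forall (B : {set T}) (gamma : T -> bool),
      unipolar (signed_set B gamma) -> signed_set B gamma \in P ->
      signed_set B (fun x => ~~ gamma x) \in P) /\
  (forall C, C \in P -> bipolar C ->
      forall x : T, ((x, true) \in C) = ((x, false) \in C)).

Definition symmetric_pair (V W : finType)
    (P : {set {set V * bool}}) (Q : {set {set W * bool}}) : Prop :=
  symmetric_parts P /\ symmetric_parts Q.

(* Main.v *)
(** Equitable pairs are closed under joins: a part of the join is a disjoint
    union of parts of any one of the joined partitions, so the column sums over
    it are constant on the parts of every joined column partition, hence on the
    parts of their join.  The join of all bound-respecting equitable pairs is
    therefore the coarsest one.  Exchanging the two signs leaves the split
    matrix unchanged and preserves equality of right-hand sides, bounds and
    costs, so it maps bound-respecting equitable pairs to such pairs, and the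
    coarsest pair is invariant under it.  Hence the sign exchange permutes its
    parts, and fixes those that meet their image, in particular the bipolar
    ones. *)
Require Import Defs.
From HB Require Import structures.
From mathcomp Require Import all_boot all_order all_algebra.
From mathcomp Require Import boolp constructive_ereal reals.

Set Implicit Arguments.
Unset Strict Implicit.
Unset Printing Implicit Defensive.

Import GRing.Theory.
Local Open Scope ring_scope.

Lemma partition_eq (T : finType) (P : {set {set T}}) (D B C : {set T}) (x : T) :
  partition P D -> B \in P -> C \in P -> x \in B -> x \in C -> B = C.
Proof.
case/and3P=> _ trivP _ BP CP xB xC.
by rewrite -(def_pblock trivP BP xB) (def_pblock trivP CP xC).
Qed.

Lemma partition_part_inhabited (T : finType) (P : {set {set T}})
    (D B : {set T}) :
  partition P D -> B \in P -> exists x, x \in B.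
Proof. by move=> partP BP; apply/set0Pn/(partition_neq0 partP). Qed.

(** The parts are the classes of the reflexive transitive closure of sharing a part of some member
    of [F]. The last clause is the minimality of the join, stated through functions so that it
    applies directly to sums of matrix entries. *)
Lemma partition_join (T : finType) (F : {set {set T}} -> Prop) :
  (forall P, F P -> partition P [set: T]) ->
  exists J : {set {set T}},
    [/\ partition J [set: T],
        forall P, F P -> refines P J &
        forall (S : Type) (f : T -> S),
          (forall P, F P -> equitable_vec f P) -> equitable_vec f J].
Proof.
move=> partF.
pose e : rel T := fun x y =>
  `[< exists P B, [/\ F P, B \in P, x \in B & y \in B] >].
have symE : symmetric e.
  by move=> x y; apply/asboolP/asboolP => -[P [B [? ? ? ?]]]; exists P, B.
have eqvE : {in [set: T] & &, equivalence_rel (connect e)}.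
  move=> x y z _ _ _; split=> [|xy]; first exact: connect0.
  exact: (same_connect (sym_connect_sym symE)).
have partJ := equivalence_partitionP eqvE.
have blockE := pblock_equivalence_partition eqvE.
set J := equivalence_partition _ _ in partJ blockE.
have [/eqP covJ trivJ _] := and3P partJ.
exists J; split=> // [P FP B BP | S f fF B BJ x y xB yB].
  have [x xB] := partition_part_inhabited (partF _ FP) BP.
  exists (pblock J x); first by rewrite pblock_mem ?covJ.
  apply/subsetP=> y yB; rewrite blockE ?inE //; apply: connect1.
  by apply/asboolP; exists P, B.
(* A path of [e]-links joins [x] to [y], and [f] keeps its value along each link. *)
have : connect e x y by rewrite -blockE ?inE // (def_pblock trivJ BJ xB).
case/connectP=> p + ->; elim: p x {xB} => //= z p IHp x /andP[xz zp].
rewrite -(IHp _ zp); move/asboolP: xz => [P [C [FP CP xC zC]]].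
exact: (fF P FP C CP).
Qed.

(** A part of [P] that meets [B] lies inside [B], since it lies in some part of [J] and the parts of
    [J] are disjoint. *)
Lemma sum_refines (R : nmodType) (T : finType) (P J : {set {set T}})
    (B : {set T}) (f : T -> R) :
  partition P [set: T] -> partition J [set: T] -> refines P J -> B \in J ->
  \sum_(x in B) f x = \sum_(C in P | C \subset B) \sum_(x in C) f x.
Proof.
move=> partP partJ refPJ BJ.
rewrite (eq_bigl (fun x => (x \in [set: T]) && (x \in B))); last first.
  by move=> x; rewrite inE.
rewrite (set_partition_big_cond _ partP) [RHS]big_mkcondr /=.
apply: eq_bigr => C CP; case: ifPn => [/subsetP subCB | nsubCB].
  by apply: eq_bigl => x; rewrite andb_idr //; apply: subCB.
rewrite big_pred0 // => x; apply: contraNF nsubCB => /andP[xC xB].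
have [D DJ subCD] := refPJ C CP.
by rewrite (partition_eq partJ BJ DJ xB (subsetP subCD x xC)).
Qed.

Section EquitablePair.

Variables (R : realType) (V W : finType) (S S' : Type).
Variables (M : V -> W -> R) (f : V -> S) (g : W -> S').

(** The vectors [f] and [g] take values in arbitrary types, so that all data on one side can be
    bundled into a single vector. *)
Definition equitable_pair (P : {set {set V}}) (Q : {set {set W}}) : Prop :=
  [/\ partition P [set: V], partition Q [set: W], equitable_mx M P Q,
      equitable_vec f P & equitable_vec g Q].

Lemma coarsest_equitable_pair_exists :
  exists (P : {set {set V}}) (Q : {set {set W}}), coarsest equitable_pair P Q.
Proof.
(* The two joins are taken separately, over all first and over all second components of equitable
   pairs. *)
have [P [partP refP minP]] :=
  @partition_join V (fun P => exists Q, equitable_pair P Q)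
    (fun P '(ex_intro Q (And5 h _ _ _ _)) => h).
have [Q [partQ refQ minQ]] :=
  @partition_join W (fun Q => exists P, equitable_pair P Q)
    (fun Q '(ex_intro P (And5 _ h _ _ _)) => h).
exists P, Q; split; last by move=> P' Q' PQ'; split;
  [apply: refP; exists Q' | apply: refQ; exists P'].
split=> //; last 2 first.
- by apply: minP => P' [Q' []].
- by apply: minQ => Q' [P' []].
move=> B C BP CQ; split.
  (* Minimality of [P] is applied to the row sum over the joined part [C]. For each [P'] this sum
     splits into sums over parts of its partner [Q'], and these are constant on the parts of
     [P']. *)
  apply: (minP _ (fun v => \sum_(w in C) M v w) _ B BP) => P' [Q' PQ'].
  have [partP' partQ' eqM _ _] := PQ'; move=> D DP' v v' vD v'D.
  have refQ' : refines Q' Q by apply: refQ; exists P'.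
  rewrite !(sum_refines _ partQ' partQ refQ' CQ).
  by apply: eq_bigr => E /andP[EQ' _]; have [eqE _] := eqM D E DP' EQ'; apply: eqE.
apply: (minQ _ (fun w => \sum_(v in B) M v w) _ C CQ) => Q' [P' PQ'].
have [partP' partQ' eqM _ _] := PQ'; move=> D DQ' w w' wD w'D.
have refP' : refines P' P by apply: refP; exists Q'.
rewrite !(sum_refines _ partP' partP refP' BP).
by apply: eq_bigr => E /andP[EP' _]; have [_ eqE] := eqM E D EP' DQ'; apply: eqE.
Qed.

Variables (sV : V -> V) (sW : W -> W).
Hypotheses (sVK : involutive sV) (sWK : involutive sW).
Hypothesis sM : forall v w, M (sV v) (sW w) = M v w.
Hypothesis sf : forall v v', f v = f v' -> f (sV v) = f (sV v').
Hypothesis sg : forall w w', g w = g w' -> g (sW w) = g (sW w').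

(** Reindexing the sums along the involutions leads back to the original pair. The vectors need not
    be invariant: preserving equality of entries suffices, which admits the sign changes of
    right-hand sides and costs. *)
Lemma equitable_pair_imset (P : {set {set V}}) (Q : {set {set W}}) :
  equitable_pair P Q ->
  equitable_pair [set sV @: (B : {set V}) | B in P]
    [set sW @: (C : {set W}) | C in Q].
Proof.
have injV := inv_inj sVK; have injW := inv_inj sWK.
have imT (T : finType) (s : T -> T) : involutive s -> s @: [set: T] = setT.
  by move=> sK; apply/setP=> x; rewrite (can2_imset_pre _ sK sK) !inE.
case=> partP partQ eqM eqf eqg; split.
- by rewrite -(imT _ _ sVK) imset_partition.
- by rewrite -(imT _ _ sWK) imset_partition.
- move=> _ _ /imsetP[B BP ->] /imsetP[C CQ ->].
  have [eqV eqW] := eqM B C BP CQ; split.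
    move=> _ _ /imsetP[v vB ->] /imsetP[v' v'B ->].
    rewrite !big_imset /=; [|exact: in2W..].
    by under eq_bigr do rewrite sM; under [RHS]eq_bigr do rewrite sM; apply: eqV.
  move=> _ _ /imsetP[w wC ->] /imsetP[w' w'C ->].
  rewrite !big_imset /=; [|exact: in2W..].
  by under eq_bigr do rewrite sM; under [RHS]eq_bigr do rewrite sM; apply: eqW.
- move=> _ /imsetP[B BP ->] _ _ /imsetP[v vB ->] /imsetP[v' v'B ->].
  exact/sf/(eqf B).
move=> _ /imsetP[C CQ ->] _ _ /imsetP[w wC ->] /imsetP[w' w'C ->].
exact/sg/(eqg C).
Qed.

End EquitablePair.

(** If [s @: B] lies in the part [C] and [s @: C] in the part [D], then [B] lies in [s @: C], hence
    in [D]. So [D] is [B], and applying [s] once more encloses [C] in [s @: B]. *)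
Lemma refines_imset_invariant (T : finType) (s : T -> T) (P : {set {set T}}) :
  involutive s -> partition P [set: T] ->
  refines [set s @: (B : {set T}) | B in P] P -> forall B, B \in P -> s @: B \in P.
Proof.
move=> sK partP ref B BP.
have ssK (A : {set T}) : s @: (s @: A) = A.
  by apply/setP=> x; rewrite !(can2_imset_pre _ sK sK) !inE sK.
have [C CP subBC] := ref _ (imset_f _ BP).
have [D DP subCD] := ref _ (imset_f _ CP).
have sub : B \subset s @: C by rewrite -[B]ssK imsetS.
have [x xB] := partition_part_inhabited partP BP.
have xD : x \in D by apply/(subsetP subCD)/(subsetP sub).
rewrite -(partition_eq partP BP DP xB xD) in subCD.
suff -> : s @: B = C by [].
by apply/eqP; rewrite eqEsubset subBC -(ssK C) imsetS.
Qed.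

Definition flip (T : Type) (x : T * bool) : T * bool := (x.1, ~~ x.2).

Lemma flipK (T : Type) : involutive (@flip T).
Proof. by case=> x s; rewrite /flip negbK. Qed.

Lemma mem_flip_imset (T : finType) (C : {set T * bool}) (x : T) (s : bool) :
  ((x, s) \in @flip T @: C) = ((x, ~~ s) \in C).
Proof. by rewrite (can2_imset_pre _ (@flipK T) (@flipK T)) inE. Qed.

Lemma symmetric_parts_flip (T : finType) (P : {set {set T * bool}}) :
  partition P [set: T * bool] -> (forall C, C \in P -> @flip T @: C \in P) ->
  symmetric_parts P.
Proof.
move=> partP flipP; split=> [B gamma _ /flipP | C CP [x [xp xm]] y].
  congr (_ \in P); apply/setP=> -[x s]; rewrite mem_flip_imset !inE /=.
  by case: s (gamma x) => -[].
have flipC : @flip T @: C = C.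
  apply: (partition_eq partP (flipP C CP) CP _ xp).
  by rewrite mem_flip_imset.
by rewrite -[in LHS]flipC mem_flip_imset.
Qed.

Section Split.

Variables (R : realType) (V W : finType) (F : lp R V W).

(* Two signed columns satisfy the conditions defining a bound-respecting
   partition exactly when they have the same signed bounds. *)
Definition signed_bounds (w : W * bool) : \bar R * \bar R :=
  if w.2 then (lp_lower F w.1, lp_upper F w.1)
  else ((- lp_upper F w.1)%E, (- lp_lower F w.1)%E).

Lemma bound_respectingE (Q : {set {set W * bool}}) :
  bound_respecting F Q <-> equitable_vec signed_bounds Q.
Proof.
split=> [brQ C CQ [w1 s1] [w2 s2] w1C w2C | eqQ C CQ w1 w2 s1 s2 w1C w2C].
  have [same opp] := brQ C CQ w1 w2 s1 s2 w1C w2C.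
  rewrite /signed_bounds /=; case: s1 s2 same opp {w1C w2C} => -[] same opp.
  - by have [//|-> ->] := same.
  - by have [//|-> ->] := opp.
  - by have [//|-> ->] := opp; rewrite !oppeK.
  - by have [//|-> ->] := same.
have := eqQ C CQ _ _ w1C w2C; rewrite /signed_bounds /=.
case: s1 s2 {w1C w2C} => -[] [e1 e2]; split=> // _; split=> //.
- by rewrite -e2 oppeK.
- by rewrite -e1 oppeK.
- exact: oppe_inj.
- exact: oppe_inj.
Qed.

Lemma bound_respecting_equitableE (P : {set {set V * bool}})
    (Q : {set {set W * bool}}) :
  bound_respecting_equitable F P Q <->
  equitable_pair (lp_mx (split_lp F)) (lp_rhs (split_lp F))
    (fun w => (signed_bounds w, lp_cost (split_lp F) w)) P Q.
Proof.
split=> [[/bound_respectingE br [[partP partQ] eqM eqb [_ _ eqc]]] |].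
  by split=> // C CQ x y xC yC; rewrite (br C CQ x y) // (eqc C CQ x y).
case=> partP partQ eqM eqb eqg.
have br : equitable_vec signed_bounds Q.
  by move=> C CQ x y xC yC; case: (eqg C CQ x y xC yC).
split; first exact/bound_respectingE.
split=> //; split=> // C CQ x y xC yC; last by case: (eqg C CQ x y xC yC).
(* The split upper bound is the second signed bound, and the split lower bound is constantly
   zero. *)
have upperE w : lp_upper (split_lp F) w = (signed_bounds w).2.
  by rewrite /signed_bounds /=; case: w.2.
by rewrite !upperE (br C CQ x y).
Qed.

Lemma coarsest_split_exists :
  exists (P : {set {set V * bool}}) (Q : {set {set W * bool}}),
    coarsest (bound_respecting_equitable F) P Q.
Proof.
have [P [Q [PQ maxPQ]]] := coarsest_equitable_pair_exists
  (lp_mx (split_lp F)) (lp_rhs (split_lp F))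
  (fun w => (signed_bounds w, lp_cost (split_lp F) w)).
exists P, Q; split; first exact/bound_respecting_equitableE.
by move=> P' Q' /bound_respecting_equitableE; apply: maxPQ.
Qed.

Lemma bound_respecting_equitable_flip (P : {set {set V * bool}})
    (Q : {set {set W * bool}}) :
  bound_respecting_equitable F P Q ->
  bound_respecting_equitable F [set @flip V @: (B : {set V * bool}) | B in P]
    [set @flip W @: (C : {set W * bool}) | C in Q].
Proof.
move=> /bound_respecting_equitableE PQ; apply/bound_respecting_equitableE.
have flip_rhs v : lp_rhs (split_lp F) (flip v) = - lp_rhs (split_lp F) v.
  by case: v => v [] /=; rewrite ?opprK.
have flip_cost w : lp_cost (split_lp F) (flip w) = - lp_cost (split_lp F) w.
  by case: w => w [] /=; rewrite ?opprK.
(* Passing from a variable to its negative negates its two bounds and swaps them. *)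
have flip_bounds w :
    signed_bounds (flip w) =
    ((- (signed_bounds w).2)%E, (- (signed_bounds w).1)%E).
  by case: w => w [] /=; rewrite /signed_bounds /= ?oppeK.
apply: equitable_pair_imset PQ; [exact: flipK|exact: flipK|..].
- by move=> [v []] [w []].
- by move=> v v' eq_v; rewrite !flip_rhs eq_v.
by move=> w w' [eq_b eq_c]; rewrite !flip_bounds !flip_cost /= eq_b eq_c.
Qed.

Lemma coarsest_split_symmetric (P : {set {set V * bool}})
    (Q : {set {set W * bool}}) :
  coarsest (bound_respecting_equitable F) P Q -> symmetric_pair P Q.
Proof.
move=> [PQ maxPQ]; have [_ [[partP partQ] _ _ _]] := PQ.
(* The flipped pair is itself a competitor, so it refines the coarsest one. *)
have [refP refQ] := maxPQ _ _ (bound_respecting_equitable_flip PQ).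
by split; apply: symmetric_parts_flip => //;
  apply: refines_imset_invariant => //; apply: flipK.
Qed.

End Split.

Theorem theorem14 (R : realType) (V W : finType)
    (A : V -> W -> R) (b : V -> R) (l u : W -> \bar R) (c : W -> R)
    (hl : forall w : W, (l w <= 0)%E) (hu : forall w : W, (0 <= u w)%E) :
  (exists (P : {set {set V * bool}}) (Q : {set {set W * bool}}),
      coarsest (bound_respecting_equitable (LP A b l u c)) P Q) /\
  (forall (P : {set {set V * bool}}) (Q : {set {set W * bool}}),
      coarsest (bound_respecting_equitable (LP A b l u c)) P Q ->
      symmetric_pair P Q).
Proof.
split; first exact: coarsest_split_exists.
exact: coarsest_split_symmetric.
Qed.
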